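(* Let $a,b\ge 2$ be integers with $\gcd(a,b)=1$, let $k$ be a positive integer dividing $(a-1)(b-1)$, and put $M_k:=\frac{(a-1)(b-1)}{k}$. Then exactly one of the following occurs. 1. $k\rho(M_k)-\Theta+1=0$. In this case the equation $ax+by=M_k$ is solvable, with $$(x,y)=\left(\frac{\Theta-1}{k},\ \frac{ab-b-a\Theta+1}{bk}\right),$$ while $1+ax+by=M_k$ is not solvable. 2. $\rho(M_k)\ge\Theta$ and $\sigma(M_k)\ge\sigma(1)$. In this case $1+ax+by=M_k$ is solvable, with $$(x,y)=\left(\rho(M_k)-\Theta,\ \sigma(M_k)-\sigma(1)\right),$$ while $ax+by=M_k$ is not solvable. 3. Neither the condition in (1) nor the conditions in (2) hold. In this case neither equation is solvable.
   Context: An equation in the unknowns $x,y$ is called solvable if it has a solution with $x,y$ nonnegative integers. For coprime integers $a,b\ge 2$ and each integer $m$, $\rho(m)\in\{0,\dots,b-1\}$ denotes the unique integer with $a\rho(m)\equiv m \pmod b$, and $\sigma(m):=\frac{m-a\rho(m)}{b}$ (an integer). $\Theta:=\rho(1)$ is the multiplicative inverse of $a$ modulo $b$ with $1\le\Theta\le b-1$. *)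

(* Defs.v *)
From HB Require Import structures.
From mathcomp Require Import all_boot all_order all_algebra.
Set Implicit Arguments.
Unset Strict Implicit.
Unset Printing Implicit Defensive.
Import Order.TTheory GRing.Theory Num.Theory.
Local Open Scope ring_scope.

(* The default value 0 is never used when 1 < b and coprimez a b, see rhoP. *)
Definition rho (a b m : int) : int :=
  if [pick r : 'I_`|b| | (a * r%:Z == m %[mod b])%Z] is Some r then r%:Z else 0.

(* The division is exact when 1 < b and coprimez a b, see sigmaP. *)
Definition sigma (a b m : int) : int := ((m - a * rho a b m) %/ b)%Z.

Definition Theta (a b : int) : int := rho a b 1.

Definition solution (E : int -> int -> Prop) (x y : int) : Prop :=
  [/\ 0 <= x, 0 <= y & E x y].

Definition solvable_eq (E : int -> int -> Prop) : Prop :=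
  exists x y : int, solution E x y.

(* A solution whose components are given as quotients of integers; that these
   quotients are integers is part of the claim. *)
Definition rat_solution (E : int -> int -> Prop) (X Y : rat) : Prop :=
  exists x y : int, [/\ X = x%:~R, Y = y%:~R & solution E x y].

Definition exactly_one (A B C : Prop) : Prop :=
  (A \/ B \/ C) /\ ~ (A /\ B) /\ ~ (A /\ C) /\ ~ (B /\ C).

Lemma rhoP (a b m : int) : 1 < b -> coprimez a b ->
  [/\ 0 <= rho a b m, rho a b m < b & (a * rho a b m = m %[mod b])%Z].
Proof.
move=> b1 cab; have b0 : 0 < b by apply: lt_trans b1.
have bE : `|b|%N%:Z = b by rewrite gez0_abs // ltW.
rewrite /rho; case: pickP => [r /eqP rP|noP].
  have rb : r%:Z < `|b|%N%:Z by rewrite ltz_nat.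
  by split; rewrite // -[X in _ < X]bE.
have /coprimezP[[u v] /= uvE] := cab.
pose w := ((u * m) %% b)%Z.
have w0 : 0 <= w by rewrite modz_ge0 // gt_eqF.
have wb : w < b by rewrite ltz_pmod.
have lt : (`|w| < `|b|)%N by rewrite -ltz_nat bE gez0_abs.
have := noP (Ordinal lt); rewrite /= gez0_abs // => /eqP[].
rewrite modzMmr -[in RHS](mul1r m) -uvE.
have -> : (u * a + v * b) * m = (v * m) * b + a * (u * m).
  by rewrite mulrDl addrC mulrAC (mulrC u) mulrA.
by rewrite modzMDl.
Qed.

Lemma rho_uniq (a b m r : int) : 1 < b -> coprimez a b ->
  0 <= r < b -> (a * r = m %[mod b])%Z -> r = rho a b m.
Proof.
move=> b1 cab rb rE; have [s0 sb sE] := rhoP m b1 cab.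
have : (a * r == a * rho a b m %[mod b])%Z by rewrite rE sE.
rewrite eqz_mod_dvd -mulrBr Gauss_dvdzr 1?coprimez_sym // -eqz_mod_dvd.
by rewrite !modz_small ?s0 // => /eqP.
Qed.

Lemma sigmaP (a b m : int) : 1 < b -> coprimez a b ->
  a * rho a b m + b * sigma a b m = m.
Proof.
move=> b1 cab; have [_ _ rE] := rhoP m b1 cab.
by rewrite /sigma [b * _]mulrC divzK ?subrKC // -eqz_mod_dvd rE.
Qed.

(* Main.v *)
Require Import Defs.
From mathcomp Require Import all_boot all_order all_algebra.
From mathcomp Require Import zify ring.
Import Order.TTheory GRing.Theory Num.Theory.
Local Open Scope ring_scope.

(** Write [T = Theta a b], [S = sigma a b 1] (so [a * T + b * S = 1]) and
[r = rho a b M], [s = sigma a b M] (so [a * r + b * s = M]), and recall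
[M * k = (a - 1) * (b - 1) < a * b].  Everything follows from two
equivalences.

- [a * x + b * y = M] is solvable iff [k * r = T - 1].  Multiplying a solution
  by [k] and reducing modulo [b] shows that [k * x] and [T - 1] are congruent;
  both are nonnegative and less than [b], so they are equal, and [x = r]
  ([solution0_coord]).  Conversely
  [k * r = T - 1] forces [k * s = a - 1 + S], which is nonnegative because
  [- a < S] ([cofactors_bounds], [solution0_of_rho]).

- [1 + a * x + b * y = M] is solvable iff [T <= r] and [S <= s].  Subtracting
  [a * T + b * S = 1] from [a * r + b * s = M] gives one direction.  For the
  other, a solution satisfies [a * (x + T) + b * (y + S) = M], so [r = x + T]
  and [s = y + S] as soon as [x + T < b].  This last inequality is the heart of
  the matter ([solution1_coord_lt]): if it fails, then a congruence modulo [b]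
  makes [k * x] so large that [M * k] exceeds [(a - 1) * (b - 1)].

The two conditions exclude each other, since [k * r = T - 1] gives [r < T]. *)

Lemma coprimez_mul_eq (a b u v : int) :
  coprimez a b -> a * u = b * v -> exists q : int, u = q * b.
Proof.
move=> cab uv; apply/dvdzP.
by rewrite -(@Gauss_dvdzr b a u) 1?coprimez_sym // uv dvdz_mulr.
Qed.

Lemma cofactors_bounds {a b T S : int} :
  2 <= a -> 2 <= b -> 0 <= T -> T < b -> a * T + b * S = 1 ->
  1 <= T /\ - a < S.
Proof.
move=> ha hb T0 Tb TS; split.
  rewrite -gtz0_ge1 lt_neqAle T0 andbT; apply/eqP => T00.
  move: TS; rewrite -T00 mulr0 add0r => bS.
  have [S0|S1] : S <= 0 \/ 1 <= S by lia.
    by nia.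
  by nia.
rewrite ltNge; apply/negP => Sa.
have : a * (T + 1) <= a * b by rewrite ler_pM2l; lia.
have : b * S <= b * (- a) by rewrite ler_pM2l; lia.
lia.
Qed.

Lemma solution0_coord {a b k M T S x y : int} :
  2 <= a -> 2 <= b -> coprimez a b -> 0 < k ->
  M * k = (a - 1) * (b - 1) ->
  0 <= T -> T < b -> a * T + b * S = 1 ->
  0 <= x -> 0 <= y -> a * x + b * y = M ->
  k * x = T - 1 /\ x < b.
Proof.
move=> ha hb cab hk MK T0 Tb TS x0 y0 E.
have [T1 _] := cofactors_bounds ha hb T0 Tb TS.
have kx0 : 0 <= k * x by rewrite mulr_ge0 // ltW.
have ky0 : 0 <= k * y by rewrite mulr_ge0 // ltW.
have E' : a * (k * x) + b * (k * y) = a * b - a - b + 1.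
  have -> : a * b - a - b + 1 = (a - 1) * (b - 1) by ring.
  by rewrite -MK -E; ring.
have kxb : k * x < b.
  rewrite -(@ltr_pM2l _ a); last lia.
  have : 0 <= b * (k * y) by rewrite mulr_ge0 //; lia.
  lia.
have [|q qE] := @coprimez_mul_eq a b (k * x - T + 1) (a - 1 + S - k * y) cab.
  have -> : a * (k * x - T + 1) = a * (k * x) - a * T + a by ring.
  have -> : b * (a - 1 + S - k * y) = a * b - b + b * S - b * (k * y) by ring.
  lia.
(* Both [k * x] and [T - 1] lie between [0] and [b - 1]. *)
have q0 : q = 0 by nia.
split; first by move: qE; rewrite q0 mul0r; lia.
by apply: le_lt_trans kxb; rewrite ler_peMl //; lia.
Qed.

Lemma solution0_of_rho {a b k M T S r s : int} :
  2 <= a -> 2 <= b -> 0 < k -> M * k = (a - 1) * (b - 1) ->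
  0 <= T -> T < b -> a * T + b * S = 1 -> a * r + b * s = M ->
  k * r = T - 1 -> k * s = a - 1 + S /\ 0 <= s.
Proof.
move=> ha hb hk MK T0 Tb TS rs kr.
have [_ Sa] := cofactors_bounds ha hb T0 Tb TS.
have ks : k * s = a - 1 + S.
  have b0 : b != 0 by lia.
  apply: (mulfI b0).
  have -> : b * (k * s) = M * k - a * (k * r) by rewrite -rs; ring.
  rewrite MK kr.
  have -> : b * (a - 1 + S) = b * a - b + b * S by ring.
  have -> : b * S = 1 - a * T by lia.
  ring.
split=> //.
by rewrite -(@pmulr_rge0 _ k) // ks; lia.
Qed.

(** Since [a * (x + T) + b * (y + S) = M], this says that [x + T] is the
reduced residue [rho a b M], not that residue plus [b]. *)
Lemma solution1_coord_lt {a b k M T S x y : int} :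
  2 <= a -> 2 <= b -> coprimez a b -> 0 < k ->
  M * k = (a - 1) * (b - 1) ->
  0 <= T -> T < b -> a * T + b * S = 1 ->
  0 <= x -> 0 <= y -> 1 + a * x + b * y = M ->
  x + T < b.
Proof.
move=> ha hb cab hk MK T0 Tb TS x0 y0 E.
have [T1 Sa] := cofactors_bounds ha hb T0 Tb TS.
rewrite ltNge; apply/negP => xT.
have E' : k + a * (k * x) + b * (k * y) = a * b - a - b + 1.
  have -> : a * b - a - b + 1 = (a - 1) * (b - 1) by ring.
  by rewrite -MK -E; ring.
have [|q qE] := @coprimez_mul_eq a b (k * (x + T) - T + 1)
                                 (a - 1 + S - k * (y + S)) cab.
  have -> : a * (k * (x + T) - T + 1)
    = (k + a * (k * x) + b * (k * y)) + k * (a * T + b * S) - k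
      - (a * T + b * S) + 1 + a - b * (k * (y + S)) + b * S - 1 by ring.
  by rewrite E' TS; ring.
(* With [u = b - T], so that [u <= x], the multiple [k * (x - u) + u + 1] of
   [b] is positive, hence at least [b]. *)
have kxu : b <= k * (x - (b - T)) + (b - T) + 1.
  have kxuE : k * (x - (b - T)) + (b - T) + 1 = (q + 1 - k) * b.
    have -> : (q + 1 - k) * b = q * b + b - k * b by ring.
    by rewrite -qE; ring.
  have kxu0 : 0 <= k * (x - (b - T)) by rewrite mulr_ge0 //; lia.
  have : 0 < (q + 1 - k) * b by rewrite -kxuE; lia.
  rewrite pmulr_lgt0 => [q1|]; last lia.
  by rewrite kxuE; apply: ler_peMl; lia.
(* Multiplied by [a], and since [1 + a * u = b * (a + S)], this bounds
   [M * k] below by [a * b - a + 1 + (k - 1) * b * (a + S)]. *)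
have := kxu; rewrite -(@ler_pM2l _ a); last lia.
have -> : a * (k * (x - (b - T)) + (b - T) + 1)
   = a * (k * x) - k * (a * b - a * T) + a * b - a * T + a by ring.
have -> : a * T = 1 - b * S by lia.
have ky0 : 0 <= b * (k * y) by rewrite !mulr_ge0 //; lia.
have kS : 0 <= (k - 1) * (b * (a + S)) by rewrite !mulr_ge0 //; lia.
have -> : k * (a * b - (1 - b * S))
  = (k - 1) * (b * (a + S)) + b * (a + S) - k by ring.
have -> : b * (a + S) = a * b + b * S by ring.
lia.
Qed.

Theorem theorem1p5 (a b k : int)
    (ha : 2 <= a) (hb : 2 <= b) (hab : coprimez a b)
    (hk : 0 < k) (hdvd : (k %| (a - 1) * (b - 1))%Z) :
  let M := (((a - 1) * (b - 1)) %/ k)%Z in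
  let E0 := fun x y : int => a * x + b * y = M in
  let E1 := fun x y : int => 1 + a * x + b * y = M in
  let C1 := k * rho a b M - Theta a b + 1 = 0 in
  let C2 := Theta a b <= rho a b M /\ sigma a b 1 <= sigma a b M in
  let C3 := ~ C1 /\ ~ C2 in
  [/\ exactly_one C1 C2 C3,
      C1 ->
        rat_solution E0
          ((Theta a b - 1)%:~R / k%:~R)
          ((a * b - b - a * Theta a b + 1)%:~R / (b * k)%:~R)
        /\ ~ solvable_eq E1,
      C2 ->
        solution E1 (rho a b M - Theta a b) (sigma a b M - sigma a b 1)
        /\ ~ solvable_eq E0
    & C3 -> ~ solvable_eq E0 /\ ~ solvable_eq E1].
Proof.
move=> M E0 E1 C1 C2 C3.
have b1 : 1 < b by lia.
have MK : M * k = (a - 1) * (b - 1) by rewrite /M divzK.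
have [T0 Tb _] := rhoP 1 b1 hab.
have TS := sigmaP 1 b1 hab.
have [r0 rb _] := rhoP M b1 hab.
have rs := sigmaP M b1 hab.
have coordE x y : 0 <= x -> x < b -> a * x + b * y = M ->
    x = rho a b M /\ y = sigma a b M.
  move=> x0 xb xyE.
  have xr : x = rho a b M.
    apply: rho_uniq; rewrite ?x0 //.
    by rewrite -xyE [b * y]mulrC addrC modzMDl.
  split=> //; have bn0 : b != 0 by lia.
  by apply: (mulfI bn0); move: xyE; rewrite xr; lia.
have solv0 : solvable_eq E0 -> C1.
  move=> [x [y [x0 y0 E]]].
  have [kx xb] := solution0_coord ha hb hab hk MK T0 Tb TS x0 y0 E.
  have [xr _] := coordE x y x0 xb E.
  by rewrite /C1 -xr /Theta kx; lia.
have solv1 : solvable_eq E1 -> C2.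
  move=> [x [y [x0 y0 E]]].
  have xT := solution1_coord_lt ha hb hab hk MK T0 Tb TS x0 y0 E.
  have [||xr ys] := coordE (x + rho a b 1) (y + sigma a b 1) _ xT.
  - exact: addr_ge0.
  - by rewrite -E -[X in _ = X + _ + _]TS; ring.
  - by rewrite /C2 -xr -ys /Theta; split; lia.
have C1_C2 : C1 -> ~ C2.
  rewrite /C1 /C2 => c1 [c2 _].
  have : rho a b M <= k * rho a b M by rewrite ler_peMl //; lia.
  lia.
split.
- split; last by rewrite /C3; tauto.
  (* Both conditions are decidable, being comparisons of integers. *)
  have [c1|nc1] := eqVneq (k * rho a b M - Theta a b + 1) 0; first by left.
  have [/andP c2|/negP nc2] :=
    boolP ((Theta a b <= rho a b M) && (sigma a b 1 <= sigma a b M)).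
    by right; left.
  right; right; split; first exact/eqP.
  by move=> /andP.
- move=> c1; split; last by move=> /solv1; exact: C1_C2.
  have kr : k * rho a b M = rho a b 1 - 1 by move: c1; rewrite /C1 /Theta; lia.
  have [ks s0] := solution0_of_rho ha hb hk MK T0 Tb TS rs kr.
  exists (rho a b M), (sigma a b M); split=> //.
    have k0 : (k%:~R : rat) != 0 by rewrite intr_eq0; lia.
    by rewrite /Theta -kr mulrC intrM mulKf.
  have bk0 : ((b * k)%:~R : rat) != 0 by rewrite intr_eq0 mulf_neq0 //; lia.
  have -> : a * b - b - a * Theta a b + 1 = b * k * sigma a b M.
    rewrite -mulrA ks.
    have -> : b * (a - 1 + sigma a b 1) = a * b - b + b * sigma a b 1 by ring.
    by rewrite /Theta; lia.
  by rewrite [in LHS]intrM mulrC mulKf.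
- move=> c2; split; last by move=> /solv0 c1; exact: (C1_C2 c1 c2).
  case: c2 => c2 c2'; split; rewrite ?subr_ge0 //.
  by rewrite /E1 /Theta -[RHS]rs -[X in X + _ + _]TS; ring.
- by move=> [nc1 nc2]; split=> [/solv0 | /solv1].
Qed.
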